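(* Suppose that (B) holds and $H_1$ is true. Let $\gamma\in(0,e^{-1})$ and suppose that $\log(\gamma^{-1})\le K\log(np)$ for some constant $K>0$. (i) If (C) holds, then there exists a constant $C:=C(\bar b,K)>0$ such that $$\mathbb P_1\left(|t_{\hat m_{1/2}}-t_m|\le\frac{C\log^2(np)}{\sqrt{n\,t_m(1-t_m)}\,|\delta_n|_\infty}\right)\ge1-\gamma .$$ (ii) If (D) holds with $q>2$, then there exists a constant $C:=C(\bar b,K,q)>0$ such that $$\mathbb P_1\left(|t_{\hat m_{1/2}}-t_m|\le\frac{C\,n^{1/q}\big(\log(np)+\gamma^{-1/q}\big)}{\sqrt{n\,t_m(1-t_m)}\,|\delta_n|_\infty}\right)\ge1-\gamma .$$
   Context: Let $n\ge 4$, $p\ge 3$. Mean-shift model: $X_i=\mu+\delta_n\mathbf 1(i>m)+\xi_i\in\mathbb R^p$, $i=1,\dots,n$, with $\mu,\delta_n\in\mathbb R^p$ and $\xi_1,\dots,\xi_n$ i.i.d. mean-zero random vectors in $\mathbb R^p$. $H_1$: $\delta_n\ne0$ and there is a change point $m\in\{1,\dots,n-1\}$. $\mathbb P_1$ denotes probability under $H_1$; $|\cdot|_\infty$ is the maximum absolute coordinate. Change point location estimator: $\hat m_{1/2}=\operatorname{argmax}_{1\le s<n}|Z_n(s)|_\infty$, where $Z_n(s)=\sqrt{\frac{s(n-s)}{n}}\Big(\frac1s\sum_{i=1}^sX_i-\frac1{n-s}\sum_{i=s+1}^nX_i\Big)$. Normalized locations: $t_m=m/n$ and $t_{\hat m_{1/2}}=\hat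 m_{1/2}/n$. Conditions, for given constants $\bar b,q>0$ and all $i=1,\dots,n$, $j=1,\dots,p$: (B) $\mathbb E|\xi_{ij}|^{2+\ell}\le\bar b^\ell$ for $\ell=1,2$. (C) $\|\xi_{ij}\|_{\psi_1}\le\bar b$, where $\|X\|_{\psi_1}=\inf\{c>0:\mathbb E[\exp(|X|/c)-1]\le1\}$. (D) $\mathbb E[\max_{1\le j\le p}(|\xi_{ij}|/\bar b)^q]\le1$. *)

(* Defs.v *)
From HB Require Import structures.
From mathcomp Require Import all_boot all_order all_algebra.
From mathcomp Require Import all_classical all_reals all_analysis.

Set Implicit Arguments.
Unset Strict Implicit.
Unset Printing Implicit Defensive.

Import Order.TTheory GRing.Theory Num.Theory.
Import numFieldNormedType.Exports.

Local Open Scope classical_set_scope.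
Local Open Scope ring_scope.

(* Vectors of R^p are row vectors 'rV[R]_p. Their library norm `|x| is mx_norm,
   the maximum absolute coordinate, so it is the norm |x|_oo. *)

Definition borel_rV (R : realType) (p : nat) :=
  g_sigma_algebraType (@open 'rV[R]_p).

Section random_variables.
Context {d : measure_display} {T : measurableType d} {R : realType}.
Variable P : probability T R.

Definition mutually_independent {I : finType} {d' : measure_display}
    {U : measurableType d'} (X : I -> T -> U) : Prop :=
  forall (J : {set I}) (A : I -> set U), (forall i, measurable (A i)) ->
    P (\bigcap_(i in [set` J]) (X i @^-1` A i)) =
    (\prod_(i in J) P (X i @^-1` A i))%E.

Definition identically_distributed {I : Type} {d' : measure_display}
    {U : measurableType d'} (X : I -> T -> U) : Prop :=
  forall (i j : I) (A : set U), measurable A ->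
    P (X i @^-1` A) = P (X j @^-1` A).

Definition iid_mean_zero {n p : nat} (xi : 'I_n -> T -> 'rV[R]_p) : Prop :=
  [/\ forall i, measurable_fun [set: T] (xi i : T -> borel_rV R p),
      mutually_independent (xi : 'I_n -> T -> borel_rV R p),
      identically_distributed (xi : 'I_n -> T -> borel_rV R p) &
      forall i j, ('E_P[fun w => xi i w ord0 j] = 0)%E].

(* The infimum is taken in \bar R: the norm is +oo when no c is admissible. *)
Definition psi1_norm (X : T -> R) : \bar R :=
  ereal_inf [set c%:E | c in
    [set c : R | 0 < c /\ ('E_P[fun w => (expR (`|X w| / c) - 1)%R] <= 1)%E]].

Definition condB {n p : nat} (b : R) (xi : 'I_n -> T -> 'rV[R]_p) : Prop :=
  forall i j (l : nat), (1 <= l <= 2)%N ->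
    ('E_P[fun w => (`|xi i w ord0 j| ^+ (2 + l))%R] <= (b ^+ l)%R%:E)%E.

Definition condC {n p : nat} (b : R) (xi : 'I_n -> T -> 'rV[R]_p) : Prop :=
  forall i j, (psi1_norm (fun w => xi i w ord0 j) <= b%:E)%E.

Definition condD {n p : nat} (b q : R) (xi : 'I_n -> T -> 'rV[R]_p) : Prop :=
  forall i,
    ('E_P[fun w => (\big[Num.max/0]_(j < p) (`|xi i w ord0 j| / b) `^ q)%R]
       <= 1)%E.

End random_variables.

Section change_point.
Context {R : realType} {n p : nat}.

(* The ordinal i : 'I_n stands for the observation number i.+1, so the shift
   indicator 1(i > m) reads m < i.+1. *)
Definition mean_shift {T : Type} (m : nat) (mu delta : 'rV[R]_p)
    (xi : 'I_n -> T -> 'rV[R]_p) (i : 'I_n) (w : T) : 'rV[R]_p :=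
  mu + delta *+ (m < i.+1)%N + xi i w.

Definition cusum (x : 'I_n -> 'rV[R]_p) (s : nat) : 'rV[R]_p :=
  Num.sqrt (s%:R * (n - s)%:R / n%:R) *:
    (s%:R^-1 *: (\sum_(i < n | (i.+1 <= s)%N) x i)
     - (n - s)%:R^-1 *: (\sum_(i < n | (s < i.+1)%N) x i)).

(* The maximizer need not be unique: an argmax estimator is any selection. *)
Definition cusum_argmax (x : 'I_n -> 'rV[R]_p) (s : nat) : Prop :=
  (1 <= s < n)%N /\
  forall r : nat, (1 <= r < n)%N -> `|cusum x r| <= `|cusum x s|.

End change_point.

Definition tloc {R : realType} (n s : nat) : R := s%:R / n%:R.

(* Main.v *)
Require Import Defs.
From HB Require Import structures.
From mathcomp Require Import all_boot all_order all_algebra.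
From mathcomp Require Import all_classical all_reals all_analysis.
From mathcomp Require Import measurable_realfun ring lra zify.

Set Implicit Arguments.
Unset Strict Implicit.
Unset Printing Implicit Defensive.

Import Order.TTheory GRing.Theory Num.Theory.
Import numFieldNormedType.Exports.

Local Open Scope classical_set_scope.
Local Open Scope ring_scope.

(** Why the theorem holds.  The CUSUM process splits into signal and noise: at
    location [s] it equals [- h s *: delta] plus the CUSUM of the [xi i], where
    the scalar profile [h] peaks at the change point with
    [h m = sqrt (n t_m (1 - t_m))] (lemmas [cusum_mean_shift] and
    [signal_profile_peak]).  The profile drops at least linearly away from its
    peak, [h m - h s >= h m * |t_s - t_m| / 2] ([signal_profile_gap]).  If the
    noise never exceeds [rho], then comparing the criterion at its maximizer
    and at [m] loses at most [2 rho], hence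
    [|t_s - t_m| <= 4 rho / (h m |delta|)] ([cusum_argmax_dist]).  What is left
    is to bound the maximum of the noise over all locations and coordinates.

    Each coordinate of the noise is a sum [\sum_i a i * xi i j] with
    [\sum_i a i ^+ 2 <= 1].  If [2 |Y|] has an exponential moment [B], then
    [E exp (a Y) <= exp (a E Y + 2 a^2 B)] for [|a| <= 1] ([mgf_le]), so by
    independence and Markov's inequality such sums have an exponential tail
    ([weighted_sum_tail]).  A union bound over the locations, the coordinates
    and the two signs costs [ln (4 n p / gamma)] ([cusum_sup_tail]), which the
    hypothesis on [gamma] makes a multiple of [ln (n p)].

    For sub-exponential noise this is applied to the coordinates themselves.
    Under the moment condition of order [q], with [u = b n^(1/q)], the vector
    [xi i] is split according to whether its norm exceeds [u].
    - The truncated part, divided by [u], is bounded by 1, so that the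
      exponential bound applies and yields a multiple of [u ln (n p)].
      Truncation biases the sum by at most [u].
    - The remainder is controlled simultaneously in all coordinates by the
      scalar sum of the [|xi i| / u] that exceed 1.  It needs no union bound over
      the coordinates, and this is why [gamma^(-1/q)] is added to [ln (n p)]
      instead of multiplying it.  Since the [q]-th moments of the [|xi i| / u]
      add up to at most 1, this sum exceeds [w] with probability of order
      [w ^ (- q)] ([heavy_sum_tail]), and [w] proportional to [gamma^(-1/q)]
      suffices. *)

(** * Expectation of a product of independent factors *)

Section independent_products.
Context {d d' : measure_display} {T : measurableType d} {U : measurableType d'}.
Context {R : realType}.
Context (P : probability T R).

Import HBNNSimple.

(** The right-hand side depends on the weight [G] only through the integrals of
    [G] over the events [X \in A]. *)
Lemma integral_nnsfun_comp_weight (X : T -> U) (G : T -> R)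
    (h : {nnsfun U >-> R}) :
  measurable_fun setT X -> measurable_fun setT G -> (forall w, 0 <= G w) ->
  (\int[P]_w (h (X w) * G w)%:E)%E =
  (\sum_(y \in range h)
     (y%:E * \int[P]_w (\1_(h @^-1` [set y]) (X w) * G w)%:E))%E.
Proof.
move=> mX mG G0.
have m1 y : measurable_fun setT (fun w => \1_(h @^-1` [set y]) (X w) * G w).
  by apply: measurable_funM => //; apply: measurableT_comp.
have g0 y w : 0 <= \1_(h @^-1` [set y]) (X w) * G w by rewrite mulr_ge0.
transitivity (\int[P]_w (\sum_(y \in range h)
    (y * (\1_(h @^-1` [set y]) (X w) * G w))%:E))%E.
  apply: eq_integral => w _.
  rewrite {1}fimfunE EFinM -fsumEFin//.
  rewrite ge0_mule_fsuml; last by move=> y; rewrite EFinM nnfun_muleindic_ge0.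
  by apply: eq_fsbigr => y _; rewrite -EFinM mulrA.
rewrite ge0_integral_fsum//; last 2 first.
- by move=> y; apply/measurable_EFinP/measurable_funM.
- move=> y w _; rewrite mulrA EFinM mule_ge0 ?lee_fin//.
  exact: nnfun_muleindic_ge0.
apply: eq_fsbigr => y /[!inE] -[u _ <-].
under eq_integral do rewrite EFinM.
rewrite ge0_integralZl_EFin//; last exact/measurable_EFinP.
by move=> w _; rewrite lee_fin.
Qed.

(** Two densities giving the events [X \in A] the same mass integrate every
    nonnegative function of [X] equally: approximate it by simple functions and
    use monotone convergence. *)
Lemma eq_integral_comp_weight (X : T -> U) (G1 G2 : T -> R) (f : U -> R) :
  measurable_fun setT X ->
  measurable_fun setT G1 -> (forall w, 0 <= G1 w) ->
  measurable_fun setT G2 -> (forall w, 0 <= G2 w) ->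
  measurable_fun setT f -> (forall u, 0 <= f u) ->
  (forall A, measurable A ->
     (\int[P]_w (\1_A (X w) * G1 w)%:E = \int[P]_w (\1_A (X w) * G2 w)%:E)%E) ->
  (\int[P]_w (f (X w) * G1 w)%:E = \int[P]_w (f (X w) * G2 w)%:E)%E.
Proof.
move=> mX mG1 G10 mG2 G20 mf f0 eqA.
have mEf : measurable_fun setT (EFin \o f) by exact/measurable_EFinP.
pose h := nnsfun_approx measurableT mEf.
have lim (G : T -> R) : measurable_fun setT G -> (forall w, 0 <= G w) ->
    (\int[P]_w (h k (X w) * G w)%:E @[k --> \oo] -->
     \int[P]_w (f (X w) * G w)%:E)%E.
  move=> mG G0.
  pose g k w := (h k (X w) * G w)%:E.
  have fE w : (f (X w) * G w)%:E = limn (g ^~ w).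
    apply/esym/cvg_lim => //; rewrite /g.
    under eq_fun do rewrite EFinM; rewrite EFinM; apply: cvgeZr => //.
    by apply: (cvg_nnsfun_approx measurableT mEf) => // u _; rewrite lee_fin.
  under [X in _ --> X]eq_integral do rewrite fE.
  apply: cvg_monotone_convergence => //.
  - move=> k; apply/measurable_EFinP/measurable_funM => //.
    exact: measurableT_comp.
  - by move=> k w _; rewrite lee_fin mulr_ge0.
  - move=> w _ a b ab; rewrite lee_fin ler_wpM2r//.
    exact/lefP/nd_nnsfun_approx.
have := lim _ mG1 G10; have := lim _ mG2 G20.
under eq_fun do rewrite integral_nnsfun_comp_weight//.
under [X in _ -> X @ _ --> _ -> _]eq_fun do rewrite integral_nnsfun_comp_weight//.
have -> : (fun k => \sum_(y \in range (h k)) y%:E *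
      \int[P]_w (\1_(h k @^-1` [set y]) (X w) * G2 w)%:E)%E =
   (fun k => \sum_(y \in range (h k)) y%:E *
      \int[P]_w (\1_(h k @^-1` [set y]) (X w) * G1 w)%:E)%E.
  by apply/funext => k; apply: eq_fsbigr => y _; rewrite eqA.
by move=> l2 l1; apply: cvg_unique l1 l2.
Qed.

End independent_products.

Lemma prod_indic (R : comPzRingType) (I : finType) (T : Type) (A : I -> set T) (w : T) :
  \prod_i \1_(A i) w = \1_(\bigcap_i A i) w :> R.
Proof.
rewrite [RHS]indicE; case: (boolP (w \in _)) => [|/negP wA].
  by rewrite inE => wA; apply: big1 => i _; rewrite indicE mem_set//; apply: wA.
have [i wi] : exists i, ~ A i w.
  by apply: contra_notP wA => /forallNP wA; rewrite inE => i _; apply: contrapT; exact: wA.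
by rewrite (bigD1 i)//= indicE memNset// mul0r.
Qed.

(** Induction on the number of factors that are not indicator functions.  When
    there are none, this is independence of events.  Otherwise one such factor
    [f j] is singled out, and the product of the others is a density which,
    by the induction hypothesis (with [f j] replaced by an indicator), gives each
    event [X j \in A] the same mass as the constant [c]. *)
Theorem integral_prod_independent {d d' : measure_display} {T : measurableType d}
    {U : measurableType d'} {R : realType} (P : probability T R) {I : finType}
    (X : I -> T -> U) (f : I -> U -> R) :
  mutually_independent P X -> (forall i, measurable_fun setT (X i)) ->
  (forall i, measurable_fun setT (f i)) -> (forall i u, 0 <= f i u) ->
  (forall i, \int[P]_w (f i (X i w))%:E < +oo)%E ->
  (\int[P]_w (\prod_i f i (X i w))%:E = \prod_i \int[P]_w (f i (X i w))%:E)%E.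
Proof.
move=> indX mX.
have [k] := ubnP #|[set i | ~~ `[< exists2 A, measurable A & f i = \1_A >]]%SET|.
elim: k f => // k IH f + mf f0 foo.
set J := [set i | _]%SET => Jk.
have [J0|[j jJ]] := set_0Vmem J.
  have /choice[A /all_and2[mA fA]] i : exists A, measurable A /\ f i = \1_A.
    have : i \notin J by rewrite J0 inE.
    by rewrite inE negbK => /asboolP[A mA fA]; exists A.
  under eq_integral.
    move=> w _; under eq_bigr do rewrite fA -[\1_(A _) _]/(\1_(X _ @^-1` A _) w).
    rewrite prod_indic; over.
  have mI i : measurable (X i @^-1` A i) by rewrite -[X in measurable X]setTI; exact: mX.
  rewrite integral_indic//; last first.
    by apply: fin_bigcap_measurable => // i _.
  have := indX [set: I]%SET A mA.
  have -> : \bigcap_(i in [set` [set: I]%SET]) (X i @^-1` A i) =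
      \bigcap_i (X i @^-1` A i).
    by apply: eq_bigcapl; split => i _ //=; rewrite inE.
  rewrite setIT => PE; etransitivity; first exact: PE.
  apply: eq_big => [i|i _]; first by rewrite inE.
  under eq_integral do rewrite fA -[\1_(A _) _]/(\1_(X _ @^-1` A _) _).
  by rewrite integral_indic// setIT.
have fin i : (\int[P]_w (f i (X i w))%:E \is a fin_num)%E.
  by rewrite ge0_fin_numE//; apply: integral_ge0 => w _; rewrite lee_fin.
pose c := \prod_(i | i != j) fine (\int[P]_w (f i (X i w))%:E)%E.
have c0 : 0 <= c.
  apply: prodr_ge0 => i _; apply/fine_ge0/integral_ge0 => w _.
  by rewrite lee_fin.
have cE : (c%:E = \prod_(i | i != j) \int[P]_w (f i (X i w))%:E)%E.
  by rewrite -prodEFin; apply: eq_bigr => i _; rewrite fineK.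
under eq_integral do rewrite (bigD1 j)//=.
rewrite (@eq_integral_comp_weight _ _ _ _ _ _ _ _ (cst c))//.
- under eq_integral do rewrite /cst EFinM.
  rewrite ge0_integralZr//; last 2 first.
  + by apply/measurable_EFinP; exact: measurableT_comp.
  + by move=> w _; rewrite lee_fin.
  + by rewrite cE [RHS](bigD1 j).
- have -> : (fun w => \prod_(i | i != j) f i (X i w)) =
      (fun w => \prod_i (if i != j then f i (X i w) else 1)).
    by apply/funext => w; rewrite big_mkcond.
  apply: measurable_prod => i _.
  by case: (i != j) => //; exact: measurableT_comp.
- by move=> w; apply: prodr_ge0.
- move=> A mA.
  pose f' i := if i == j then \1_A else f i : U -> R.
  have f'j i w : i != j -> f' i w = f i w by rewrite /f' => /negPf ->.
  have f'jj : f' j = \1_A by rewrite /f' eqxx.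
  have := IH f'; rewrite (bigD1 j)//= f'jj => IHf.
  transitivity (\int[P]_w (\prod_i f' i (X i w))%:E)%E.
    apply: eq_integral => w _; rewrite [in RHS](bigD1 j)//= f'jj.
    by congr (_ * _)%:E; apply: eq_bigr => i ij; rewrite f'j.
  rewrite IHf.
  + under [RHS]eq_integral do rewrite /cst EFinM.
    rewrite ge0_integralZr//; last first.
      by apply/measurable_EFinP; exact: measurableT_comp.
    rewrite cE; congr (_ * _)%E; apply: eq_bigr => i ij.
    by apply: eq_integral => w _; rewrite f'j.
  + rewrite -ltnS; apply: leq_trans Jk; rewrite ltnS.
    apply: proper_card; apply/properP; split.
      apply/fintype.subsetP => i; rewrite !inE /f'.
      case: eqP => // _ /negP; case; apply/asboolP.
      by exists A.
    exists j => //; rewrite inE negbK f'jj.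
    by apply/asboolP; exists A.
  + move=> i; rewrite /f'; case: eqP => // _.
  + by move=> i u; rewrite /f'; case: eqP.
  + move=> i; rewrite /f'; case: eqP => // _.
    under eq_integral do rewrite -[\1_A _]/(\1_(X i @^-1` A) _).
    have mXA : measurable (X i @^-1` A) by rewrite -[X in measurable X]setTI; exact: mX.
    by rewrite integral_indic// (le_lt_trans (probability_le1 _ _))// ?ltry// setIT.
Qed.

(** * Exponential tails of weighted sums *)

Lemma expR_le_quadratic (R : realType) (x : R) :
  expR x <= 1 + x + x ^+ 2 * expR `|x|.
Proof.
have e1 : expR x - 1 <= x * expR x.
  have := expR_ge1Dx (- x); rewrite -(ler_pM2r (expR_gt0 x)) -expRD addNr expR0.
  by lra.
have e2 := expR_ge1Dx x.
have [x0|x0] := leP 0 x.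
  rewrite ger0_norm//.
  have := ler_wpM2l x0 e1; have := expR_gt0 x; nra.
have : 1 <= expR `|x| by rewrite -expR0 ler_expR.
have : 0 <= x ^+ 2 by exact: sqr_ge0.
by rewrite expr2; nra.
Qed.

Lemma sqr_le_expR (R : realType) (x : R) : x ^+ 2 <= 2 * expR `|x|.
Proof.
have := expR_ge1Dxn 1 (normr_ge0 x).
rewrite real_normK ?num_real// (_ : 2`!%:R = 2 :> R)//.
by lra.
Qed.

(** The quadratic term carries the factor [a ^+ 2], which is what makes weights of
    unit square sum harmless; the growth of the exponential and of [x ^+ 2] is
    absorbed in [expR (2 * `|x|)]. *)
Lemma expRM_le_quadratic (R : realType) (a x : R) : `|a| <= 1 ->
  expR (a * x) <= 1 + a * x + 2 * a ^+ 2 * expR (2 * `|x|).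
Proof.
move=> a1; apply: (le_trans (expR_le_quadratic _)); rewrite lerD2l.
have -> : expR (2 * `|x|) = expR `|x| * expR `|x|.
  by rewrite -expRD; congr expR; ring.
have ax : expR `|a * x| <= expR `|x|.
  by rewrite ler_expR normrM ler_piMl.
have -> : 2 * a ^+ 2 * (expR `|x| * expR `|x|) =
    a ^+ 2 * (2 * expR `|x|) * expR `|x| by ring.
rewrite exprMn; apply: ler_pM => //; first by rewrite mulr_ge0 ?sqr_ge0.
by rewrite ler_wpM2l ?sqr_ge0// sqr_le_expR.
Qed.

Lemma norm_le1_sum_sqr (R : realDomainType) (I : finType) (a : I -> R) (i : I) :
  \sum_k a k ^+ 2 <= 1 -> `|a i| <= 1.
Proof.
move=> a1; rewrite -(@ler_pXn2r _ 2)// ?nnegrE// expr1n real_normK ?num_real//.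
apply: le_trans a1; rewrite (bigD1 i)//= lerDl.
by apply: sumr_ge0 => k _; exact: sqr_ge0.
Qed.

Section exponential_tails.
Context {d : measure_display} {T : measurableType d} {R : realType}.
Context (P : probability T R).

Lemma measurable_gt (f : T -> R) (x : R) : measurable_fun setT f ->
  measurable [set w | x < f w].
Proof.
move=> mf; rewrite (_ : [set w | _] = setT `&` f @^-1` `]x, +oo[); first exact: mf.
by rewrite setTI; apply/seteqP; split => w /=; rewrite in_itv/= andbT.
Qed.

Lemma union_bound {I : finType} (F : I -> set T) :
  (forall i, measurable (F i)) ->
  measurable (\bigcup_i F i) /\ (P (\bigcup_i F i) <= \sum_i P (F i))%E.
Proof.
move=> mF.
have -> : \bigcup_i F i = \big[setU/set0]_i F i.
  by rewrite -bigcup_seq; apply: eq_bigcupl; split => i //= _; rewrite mem_index_enum.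
pose K (A : set T) (y : \bar R) := measurable A /\ (P A <= y)%E.
apply: (big_ind2 K) => [|A y B z [mA Ay] [mB Bz]|i _].
- by split; rewrite ?measure0.
- split; first exact: measurableU.
  by apply: (le_trans (measureU2 _ _ _)) => //; exact: leeD.
- by split.
Qed.

Lemma integrable_mgf (Y : T -> R) (B : R) : measurable_fun setT Y ->
  (\int[P]_w (expR (2 * `|Y w|))%:E <= B%:E)%E ->
  P.-integrable setT (EFin \o Y).
Proof.
move=> mY YB.
have m2 : measurable_fun setT (fun w => expR (2 * `|Y w|)).
  apply: measurableT_comp => //; apply: measurable_funM => //.
  exact: measurableT_comp.
apply: (@le_integrable _ _ _ _ _ _ _ (fun w => (expR (2 * `|Y w|))%:E)) => //.
- exact/measurable_EFinP.
- move=> w _ /=; rewrite lee_fin [leRHS]ger0_norm ?expR_ge0//.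
  by have := expR_ge1Dx (2 * `|Y w|); have := normr_ge0 (Y w); lra.
- apply/integrableP; split; first exact/measurable_EFinP.
  under eq_integral do rewrite /= ger0_norm ?expR_ge0//.
  by rewrite (le_lt_trans YB)// ltry.
Qed.

(** Integrate the quadratic bound and use [1 + x <= expR x]. *)
Lemma mgf_le (Y : T -> R) (a B : R) : measurable_fun setT Y -> `|a| <= 1 ->
  (\int[P]_w (expR (2 * `|Y w|))%:E <= B%:E)%E ->
  (\int[P]_w (expR (a * Y w))%:E <=
     (expR (a * fine (\int[P]_w (Y w)%:E) + 2 * a ^+ 2 * B))%:E)%E.
Proof.
move=> mY a1 YB.
have iY := integrable_mgf mY YB.
have m2 : measurable_fun setT (fun w => expR (2 * `|Y w|)).
  apply: measurableT_comp => //; apply: measurable_funM => //.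
  exact: measurableT_comp.
have iE : P.-integrable setT (EFin \o (fun w => expR (2 * `|Y w|))).
  apply/integrableP; split; first exact/measurable_EFinP.
  under eq_integral do rewrite /= ger0_norm ?expR_ge0//.
  by rewrite (le_lt_trans YB)// ltry.
have i1 : P.-integrable setT (fun w => (1 + a * Y w)%:E).
  apply: (@integrableD _ _ _ _ _ measurableT (EFin \o cst 1)
            (fun w => a%:E * (Y w)%:E)%E).
    exact: finite_measure_integrable_cst.
  exact: (integrableZl measurableT a iY).
have i2 : P.-integrable setT (fun w => (2 * a ^+ 2 * expR (2 * `|Y w|))%:E).
  exact: (integrableZl measurableT (2 * a ^+ 2) iE).
apply: (@le_trans _ _
  (\int[P]_w ((1 + a * Y w)%:E + (2 * a ^+ 2 * expR (2 * `|Y w|))%:E)))%E.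
  apply: ge0_le_integral => //.
  - apply/measurable_EFinP/measurableT_comp => //.
    exact: measurable_funM.
  - apply/measurable_EFinP/measurable_funD; first apply: measurable_funD => //.
      exact: measurable_funM.
    exact: measurable_funM.
  - by move=> w _; rewrite -EFinD lee_fin expRM_le_quadratic.
rewrite integralD//.
under eq_integral do rewrite EFinD.
rewrite integralD//; last 2 first.
- exact: finite_measure_integrable_cst.
- exact: (integrableZl measurableT a iY).
rewrite integral_cst//= probability_setT mule1.
under eq_integral do rewrite EFinM.
rewrite integralZl//.
under [X in (_ + X <= _)%E]eq_integral do rewrite EFinM.
rewrite integralZl//.
have fY : (\int[P]_w (Y w)%:E \is a fin_num)%E by exact: integrable_fin_num iY.
apply: (@le_trans _ _ (1 + a * fine (\int[P]_w (Y w)%:E) + 2 * a ^+ 2 * B)%:E).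
  rewrite !EFinD !EFinM fineK//; apply: leeD => //.
  apply: lee_pmul => //; first by rewrite -EFinM lee_fin mulr_ge0 ?sqr_ge0.
  by apply: integral_ge0 => w _; rewrite lee_fin expR_ge0.
by rewrite lee_fin -addrA expR_ge1Dx.
Qed.

Lemma chernoff_independent {d' : measure_display} {U : measurableType d'}
    {I : finType} (X : I -> T -> U) (g : I -> U -> R) (c : I -> R) (x : R) :
  mutually_independent P X -> (forall i, measurable_fun setT (X i)) ->
  (forall i, measurable_fun setT (g i)) ->
  (forall i, \int[P]_w (expR (g i (X i w)))%:E <= (expR (c i))%:E)%E ->
  (P [set w | (x < \sum_i g i (X i w))%R] <= (expR (\sum_i c i - x))%:E)%E.
Proof.
move=> indX mX mg gc.
have mS : measurable_fun setT (fun w => \sum_i g i (X i w)).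
  by apply: measurable_sum => i; exact: measurableT_comp.
set A := [set w | _].
have mA : measurable A.
  exact: measurable_gt.
rewrite -(setIT A) -integral_indic//.
apply: (@le_trans _ _
    (\int[P]_w ((\prod_i expR (g i (X i w)))%:E * (expR (- x))%:E))%E).
  apply: ge0_le_integral => //.
  - exact/measurable_EFinP.
  - apply/measurable_EFinP/measurable_funM => //.
    apply: measurable_prod => i _.
    by apply: measurableT_comp => //; exact: measurableT_comp.
  - move=> w _; rewrite -EFinM lee_fin -expR_sum -expRD indicE.
    have [|_] := boolP (w \in A); last exact: expR_ge0.
    by rewrite inE /A /= => xS; rewrite -[leLHS]expR0 ler_expR subr_ge0 ltW.
have e0 w : 0 <= \prod_i expR (g i (X i w)) by apply: prodr_ge0 => i _; exact: expR_ge0.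
rewrite ge0_integralZr//; last 2 first.
- apply/measurable_EFinP; apply: measurable_prod => i _.
  by apply: measurableT_comp => //; exact: measurableT_comp.
- by move=> w _; rewrite lee_fin.
rewrite (integral_prod_independent (f := fun i u => expR (g i u)) indX)//; last 2 first.
- by move=> i; exact: measurableT_comp.
- by move=> i; rewrite (le_lt_trans (gc i))// ltry.
rewrite expRD EFinM lee_wpmul2r ?lee_fin ?expR_ge0//.
rewrite expR_sum -prodEFin.
pose K (a b : \bar R) := (0 <= a <= b)%E.
suff /andP[] : K (\prod_i \int[P]_w (expR (g i (X i w)))%:E)%E (\prod_i (expR (c i))%:E)%E by [].
apply: (big_ind2 K); rewrite /K.
- by rewrite lexx lee_fin ler01.
- by move=> a1 b1 a2 b2 /andP[? ?] /andP[? ?]; rewrite mule_ge0//= lee_pmul.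
- move=> i _; rewrite gc andbT; apply: integral_ge0 => w _.
  by rewrite lee_fin expR_ge0.
Qed.

(** The exponential moments of the weighted terms multiply, and the quadratic terms
    of their exponents add up to at most [2 * B]. *)
Lemma weighted_sum_tail {d' : measure_display} {U : measurableType d'}
    {I : finType} (X : I -> T -> U) (Y : I -> U -> R) (a : I -> R) (B x : R) :
  mutually_independent P X -> (forall i, measurable_fun setT (X i)) ->
  (forall i, measurable_fun setT (Y i)) -> 0 <= B ->
  (forall i, \int[P]_w (expR (2 * `|Y i (X i w)|))%:E <= B%:E)%E ->
  \sum_i a i ^+ 2 <= 1 ->
  (P [set w | (x < \sum_i a i * Y i (X i w))%R] <=
   (expR (\sum_i a i * fine (\int[P]_w (Y i (X i w))%:E) + 2 * B - x))%:E)%E.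
Proof.
move=> indX mX mY B0 YB a1.
have ai i := norm_le1_sum_sqr i a1.
have mYX i : measurable_fun setT (fun w => Y i (X i w)) by exact: measurableT_comp.
have mg i : measurable_fun setT (fun u => a i * Y i u) by exact: measurable_funM.
apply: (le_trans (chernoff_independent (g := fun i u => a i * Y i u) x indX mX mg
  (fun i => mgf_le (mYX i) (ai i) (YB i)))).
rewrite lee_fin ler_expR lerD2r big_split/= lerD2l -mulr_suml -mulr_sumr.
by rewrite ler_wpM2r// ler_piMr.
Qed.

End exponential_tails.

(** * Signal and noise in the CUSUM process *)

Section cusum_weights.
Context {R : realType} {n : nat}.

Definition cusum_weight (s : nat) (i : 'I_n) : R :=
  Num.sqrt (s%:R * (n - s)%:R / n%:R) *
    (if (i < s)%N then s%:R^-1 else - (n - s)%:R^-1).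

Lemma cusumE {p : nat} (x : 'I_n -> 'rV[R]_p) (s : nat) (j : 'I_p) :
  cusum x s ord0 j = \sum_i cusum_weight s i * x i ord0 j.
Proof.
rewrite !mxE !summxE mulrBr !mulr_sumr [X in X - _]big_mkcond [X in _ - X]big_mkcond -sumrB.
apply: eq_bigr => i _; rewrite /cusum_weight ltnS [(s <= i)%N]leqNgt.
by case: ifP => _ /=; ring.
Qed.

Lemma sum_ord_lt (k : nat) (c : R) : (k <= n)%N ->
  \sum_(i < n | (i < k)%N) c = k%:R * c.
Proof.
by move=> kn; rewrite -(big_ord_widen _ (fun=> c) kn) sumr_const card_ord mulr_natl.
Qed.

Lemma sum_ord_ge (k : nat) (c : R) : (k <= n)%N ->
  \sum_(i < n | ~~ (i < k)%N) c = (n - k)%:R * c.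
Proof.
move=> kn; have := sum_ord_lt c (leqnn n).
rewrite (eq_bigl predT); last by move=> i /=; rewrite ltn_ord.
rewrite (bigID (fun i : 'I_n => i < k)%N)/= sum_ord_lt// natrB// => e.
by rewrite mulrBl -e addrAC subrr add0r.
Qed.

(** The sum is 1 for [0 < s] and 0 for [s = 0], where the square root vanishes;
    the inequality covers all [s < n], so that locations can range over ['I_n]. *)
Lemma sum_cusum_weight_sqr (s : nat) : (s < n)%N ->
  \sum_i cusum_weight s i ^+ 2 <= 1.
Proof.
move=> sn; have n0 : (0 < n)%N by exact: leq_ltn_trans sn.
have ns0 : (n - s)%:R != 0 :> R by rewrite pnatr_eq0 subn_eq0 -ltnNge.
have n0' : n%:R != 0 :> R by rewrite pnatr_eq0 -lt0n.
have [->|s0] := eqVneq s 0.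
  rewrite big1// => i _; rewrite /cusum_weight !mul0r sqrtr0 mul0r expr0n//.
have s0' : s%:R != 0 :> R by rewrite pnatr_eq0.
under eq_bigr do rewrite /cusum_weight exprMn sqr_sqrtr ?divr_ge0 ?mulr_ge0//.
rewrite -mulr_sumr (bigID (fun i : 'I_n => i < s)%N)/=.
under eq_bigr => i -> do [].
under [X in _ + X]eq_bigr => i /negPf -> do [].
rewrite sum_ord_lt ?(ltnW sn)// sum_ord_ge ?(ltnW sn)//.
have -> : n%:R = s%:R + (n - s)%:R :> R by rewrite -natrD subnKC// ltnW.
rewrite (_ : _ * _ = 1)//; field.
by rewrite s0' ns0 /= -natrD subnKC ?(ltnW sn).
Qed.

Lemma cusum_weight_le1 (s : nat) (i : 'I_n) : (s < n)%N ->
  `|cusum_weight s i| <= 1.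
Proof. by move=> /sum_cusum_weight_sqr; exact: norm_le1_sum_sqr. Qed.

(** The norm of the noiseless CUSUM at [s], per unit of [delta], when the change
    occurs at [m]. *)
Definition signal_profile (m s : nat) : R :=
  Num.sqrt (s%:R * (n - s)%:R / n%:R) *
    (if (s <= m)%N then (n - m)%:R / (n - s)%:R else m%:R / s%:R).

Lemma sum_cusum_weight_tail (m s : nat) : (m < n)%N -> (0 < s < n)%N ->
  \sum_(i < n | ~~ (i < m)%N) cusum_weight s i = - signal_profile m s.
Proof.
move=> mn /andP[s0 sn].
have ns0 : (n - s)%:R != 0 :> R by rewrite pnatr_eq0 subn_eq0 -ltnNge.
have s0' : s%:R != 0 :> R by rewrite pnatr_eq0 -lt0n.
rewrite /cusum_weight /signal_profile -mulr_sumr -mulrN; congr (_ * _).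
have [sm|ms] := leqP s m.
  rewrite (eq_bigr (fun=> - (n - s)%:R^-1)); last first.
    by move=> i; rewrite -leqNgt => mi; rewrite ltnNge (leq_trans sm mi).
  by rewrite sum_ord_ge 1?ltnW// mulrN.
have -> : \sum_(i < n | ~~ (i < m)%N) (if (i < s)%N then s%:R^-1 else - (n - s)%:R^-1) =
  \sum_(i < n) (if (i < s)%N then s%:R^-1 else - (n - s)%:R^-1) -
  \sum_(i < n | (i < m)%N) (if (i < s)%N then s%:R^-1 else - (n - s)%:R^-1) :> R.
  by rewrite [in RHS](bigID (fun i : 'I_n => i < m)%N)/= addrAC subrr add0r.
rewrite [X in X - _](bigID (fun i : 'I_n => i < s)%N)/=.
under [X in X + _ - _]eq_bigr => i -> do [].
under [X in _ + X - _]eq_bigr => i /negPf -> do [].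
rewrite [X in _ - X](eq_bigr (fun=> s%:R^-1)); last first.
  by move=> i im; rewrite (ltn_trans im ms).
rewrite !sum_ord_lt 1?ltnW// sum_ord_ge 1?ltnW//.
by field; rewrite s0' ns0.
Qed.

Lemma cusum_mean_shift {p : nat} {T : Type} (m s : nat) (mu delta : 'rV[R]_p)
    (xi : 'I_n -> T -> 'rV[R]_p) (w : T) : (m < n)%N -> (0 < s < n)%N ->
  cusum (fun i => mean_shift m mu delta xi i w) s =
    - signal_profile m s *: delta + cusum (xi ^~ w) s.
Proof.
move=> mn sn; apply/rowP => j; rewrite [RHS]mxE !cusumE.
have n0 : (0 < n)%N by exact: leq_ltn_trans mn.
under eq_bigr do rewrite !mxE mulmxnE mulrDr mulrDr.
rewrite !big_split/=; congr (_ + _).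
rewrite -mulr_suml.
(* The common mean [mu] cancels: the weights add up to 0, which is the previous
   lemma for a change point at 0. *)
have -> : \sum_i cusum_weight s i = 0.
  have := @sum_cusum_weight_tail 0 s n0 sn.
  case/andP: sn => s0 _.
  rewrite /signal_profile leqNgt s0 /= mul0r mulr0 oppr0 => e; rewrite -[RHS]e.
  exact: eq_bigl.
rewrite mul0r add0r mxE -sum_cusum_weight_tail// mulr_suml [RHS]big_mkcond.
by apply: eq_bigr => i _; rewrite -leqNgt ltnS; case: leqP => _ /=; rewrite ?mulr1n// mulr0n mulr0.
Qed.

End cusum_weights.

Arguments signal_profile {R} n m s.

(** * Localization of the maximizer *)

(** The squared quotient of the profiles at [s] and [m] is
    [s (n - m) / ((n - s) m)], which is at most [1 - (m - s) / n]: this reduces to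
    [(n - s) m <= n ^+ 2].  Squares are compared to avoid the square roots. *)
Lemma profile_gap_sqr (R : realFieldType) (n m s : R) : 0 < s -> s <= m -> m < n ->
  s * (n - m) ^+ 2 / (n * (n - s)) <=
    m * (n - m) / n * (1 - (m - s) / (2 * n)) ^+ 2.
Proof.
move=> s0 sm mn.
have n0 : 0 < n by lra.
have ns0 : 0 < n - s by lra.
have m0 : 0 < m by lra.
have k0 : 0 <= m * (n - m) / n by rewrite divr_ge0 ?mulr_ge0; lra.
apply: (@le_trans _ _ (m * (n - m) / n * (1 - (m - s) / n))).
  rewrite -subr_ge0.
  rewrite (_ : _ - _ = (m - s) * (n - m) * (n ^+ 2 - (n - s) * m) / (n ^+ 2 * (n - s))).
    by apply: divr_ge0; first apply: mulr_ge0; first apply: mulr_ge0; nra.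
  by field; rewrite !gt_eqF//.
rewrite ler_wpM2l// -subr_ge0.
rewrite (_ : _ - _ = ((m - s) / (2 * n)) ^+ 2) ?sqr_ge0//.
by field; rewrite gt_eqF.
Qed.

Section localization.
Context {R : realType} {n : nat}.

Let sqrt_profile (m s : nat) : (0 < s < n)%N -> (m < n)%N ->
  signal_profile n m s ^+ 2 =
    if (s <= m)%N then s%:R * (n%:R - m%:R) ^+ 2 / (n%:R * (n%:R - s%:R))
    else (n%:R - s%:R) * m%:R ^+ 2 / (n%:R * s%:R) :> R.
Proof.
move=> /andP[s0 sn] mn.
have ns0 : (n%:R - s%:R) != 0 :> R.
  by rewrite -natrB ?(ltnW sn)// pnatr_eq0 subn_eq0 -ltnNge.
have s0' : s%:R != 0 :> R by rewrite pnatr_eq0 -lt0n.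
have n0 : n%:R != 0 :> R by rewrite pnatr_eq0 -lt0n (leq_ltn_trans _ sn).
rewrite /signal_profile exprMn sqr_sqrtr ?divr_ge0 ?mulr_ge0//.
rewrite !natrB ?(ltnW sn) ?(ltnW mn)//.
by case: ifP => _; field; rewrite ?n0 ?ns0 ?s0'.
Qed.

Lemma signal_profile_ge0 (m s : nat) : 0 <= signal_profile n m s :> R.
Proof.
by rewrite /signal_profile mulr_ge0 ?sqrtr_ge0//; case: ifP => _; rewrite divr_ge0.
Qed.

Lemma signal_profile_gap (m s : nat) : (0 < m < n)%N -> (0 < s < n)%N ->
  signal_profile n m m * `|tloc n s - tloc n m| / 2 <=
    signal_profile n m m - signal_profile n m s :> R.
Proof.
move=> /[dup] m_in /andP[m0 mn] /[dup] s_in /andP[s0 sn].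
set h := signal_profile n m m; set hs := signal_profile n m s.
set t := `|_ - _|.
have n0 : 0 < n%:R :> R by rewrite ltr0n (leq_ltn_trans _ sn).
have mR : (0 < m%:R :> R) /\ (m%:R < n%:R :> R) by rewrite ltr0n ltr_nat.
have sR : (0 < s%:R :> R) /\ (s%:R < n%:R :> R) by rewrite ltr0n ltr_nat.
have t1 : t <= 1.
  rewrite /t /tloc -mulrBl normrM [`|_^-1|]gtr0_norm ?invr_gt0// ler_pdivrMr//.
  by rewrite mul1r ler_norml; apply/andP; split; lra.
suff : hs ^+ 2 <= (h * (1 - t / 2)) ^+ 2.
  have h0 : 0 <= h by exact: signal_profile_ge0.
  have ht0 : 0 <= h * (1 - t / 2) by apply: mulr_ge0 => //; lra.
  by rewrite ler_pXn2r// ?nnegrE ?signal_profile_ge0//; lra.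
rewrite [leRHS]exprMn /h /hs !sqrt_profile// leqnn.
have -> : m%:R * (n%:R - m%:R) ^+ 2 / (n%:R * (n%:R - m%:R)) = m%:R * (n%:R - m%:R) / n%:R :> R.
  by field; rewrite !gt_eqF//; lra.
case: leqP => [sm|ms].
  have sm' : s%:R <= m%:R :> R by rewrite ler_nat.
  have -> : t / 2 = (m%:R - s%:R) / (2 * n%:R).
    rewrite /t /tloc -mulrBl normrM [`|_^-1|]gtr0_norm ?invr_gt0// distrC ger0_norm ?subr_ge0//.
    by field; rewrite gt_eqF.
  by apply: profile_gap_sqr; lra.
(* The case [m < s] is the mirror image under [s |-> n - s], [m |-> n - m]. *)
have ms' : m%:R < s%:R :> R by rewrite ltr_nat.
have -> : t / 2 = ((n%:R - m%:R) - (n%:R - s%:R)) / (2 * n%:R).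
  rewrite /t /tloc -mulrBl normrM [`|_^-1|]gtr0_norm ?invr_gt0// gtr0_norm ?subr_gt0//.
  by field; rewrite gt_eqF.
have := @profile_gap_sqr R n%:R (n%:R - m%:R) (n%:R - s%:R).
by rewrite !subKr [m%:R * _]mulrC; apply; lra.
Qed.

Lemma signal_profile_peak (m : nat) : (0 < m < n)%N ->
  signal_profile n m m = Num.sqrt (n%:R * tloc n m * (1 - tloc n m)) :> R.
Proof.
move=> /andP[m0 mn].
have n0 : n%:R != 0 :> R by rewrite pnatr_eq0 -lt0n (leq_ltn_trans _ mn).
rewrite /signal_profile leqnn divff ?mulr1 ?pnatr_eq0 ?subn_eq0 -?ltnNge//.
by rewrite /tloc natrB ?(ltnW mn)//; congr Num.sqrt; field.
Qed.

(** Since [s] beats [m], [h m |delta| - rho <= h s |delta| + rho]; the gap between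
    [h m] and [h s] then bounds the distance. *)
Lemma cusum_argmax_dist {p : nat} {T : Type} (m s : nat) (mu delta : 'rV[R]_p)
    (xi : 'I_n -> T -> 'rV[R]_p) (w : T) (rho : R) :
  (0 < m < n)%N -> delta != 0 ->
  (forall r, (0 < r < n)%N -> `|cusum (xi ^~ w) r| <= rho) ->
  cusum_argmax (fun i => mean_shift m mu delta xi i w) s ->
  `|tloc n s - tloc n m| <=
    4 * rho / (Num.sqrt (n%:R * tloc n m * (1 - tloc n m)) * `|delta|).
Proof.
move=> m_in d0 noise [s_in /(_ m m_in)].
have mn : (m < n)%N by case/andP: m_in.
rewrite !cusum_mean_shift// => le_ms.
have nZ r : `|- signal_profile n m r *: delta| = signal_profile n m r * `|delta|.
  by rewrite scaleNr normrN normrZ ger0_norm ?signal_profile_ge0.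
have {le_ms} : signal_profile n m m * `|delta| - rho <= signal_profile n m s * `|delta| + rho.
  rewrite -!nZ; apply: (le_trans _ (le_trans le_ms _)).
    apply: (le_trans (lerB (lexx _) (noise m m_in))).
    exact: lerB_normD.
  exact: (le_trans (ler_normD _ _) (lerD (lexx _) (noise s s_in))).
have := signal_profile_gap m_in s_in.
rewrite signal_profile_peak//; set h := Num.sqrt _; set t := `|_ - _| => gap le_ms.
have d1 : 0 < `|delta| by rewrite normr_gt0.
have h0 : 0 < h.
  rewrite sqrtr_gt0; case/andP: m_in => m0 _.
  have n0 : 0 < n%:R :> R by rewrite ltr0n (leq_ltn_trans _ mn).
  have tm1 : tloc n m < 1 :> R by rewrite /tloc ltr_pdivrMr// mul1r ltr_nat.
  have tm0 : 0 < tloc n m :> R by rewrite /tloc divr_gt0// ltr0n.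
  by apply: mulr_gt0; [exact: mulr_gt0|rewrite subr_gt0].
rewrite ler_pdivlMr ?mulr_gt0//.
by move: gap; rewrite -(ler_pM2r d1) => gap; nra.
Qed.

End localization.

(** * Uniform bound for the noise *)

Section cusum_tails.
Context {d : measure_display} {T : measurableType d} {R : realType}.
Context (P : probability T R).

(** Each of the [2 n p] signed sums exceeds the level with probability at most
    [gamma / (4 n p)].  The bound [D] allows for variables that are not centred,
    as happens after truncation. *)
Lemma cusum_sup_tail {d' : measure_display} {U : measurableType d'} {n p : nat}
    (X : 'I_n -> T -> U) (Y : 'I_p -> U -> R) (B D gamma : R) :
  mutually_independent P X -> (forall i, measurable_fun setT (X i)) ->
  (forall j, measurable_fun setT (Y j)) -> 0 <= B -> 0 < gamma ->
  (0 < n)%N -> (0 < p)%N ->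
  (forall i j, \int[P]_w (expR (2 * `|Y j (X i w)|))%:E <= B%:E)%E ->
  (forall s j, (s < n)%N ->
     `|\sum_i cusum_weight s i * fine (\int[P]_w (Y j (X i w))%:E)| <= D) ->
  exists N : set T, [/\ measurable N, (P N <= (gamma / 2)%:E)%E &
    forall w, ~ N w -> forall s j, (s < n)%N ->
      `|\sum_i cusum_weight s i * Y j (X i w)| <=
        D + 2 * B + ln (4 * (n * p)%:R / gamma)].
Proof.
move=> indX mX mY B0 g0 n0 p0 YB YD.
set x := D + _ + _.
pose sgn (b : bool) : R := (-1) ^+ b.
pose F (k : 'I_n * 'I_p * bool) :=
  [set w | x < \sum_i (sgn k.2 * cusum_weight k.1.1 i) * Y k.1.2 (X i w)].
have mF k : measurable (F k).
  apply: measurable_gt; apply: measurable_sum => i.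
  by apply: measurable_funM => //; exact: measurableT_comp.
have [mN PN] := union_bound P mF.
have np0 : 0 < (n * p)%:R :> R by rewrite ltr0n muln_gt0 n0.
exists (\bigcup_k F k); split => //.
- apply: (le_trans PN).
  apply: (@le_trans _ _ (\sum_(k : 'I_n * 'I_p * bool) (gamma / (4 * (n * p)%:R))%:E)%E).
    apply: lee_sum => -[[s j] b] _.
    apply: (le_trans (weighted_sum_tail x indX mX (fun=> mY j) B0 _ _)) => [i|//|].
    - exact: YB.
    - under eq_bigr do rewrite exprMn sqrr_sign mul1r.
      exact: sum_cusum_weight_sqr.
    - rewrite lee_fin /=.
      have -> : gamma / (4 * (n * p)%:R) = expR (- ln (4 * (n * p)%:R / gamma)).
        by rewrite expRN lnK ?posrE ?divr_gt0 ?mulr_gt0// invf_div.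
      rewrite ler_expR.
      under eq_bigr do rewrite -mulrA.
      rewrite -mulr_sumr.
      have : sgn b * (\sum_i cusum_weight s i * fine (\int[P]_w (Y j (X i w))%:E)) <= D.
        apply: (le_trans (ler_norm _)); rewrite normrM normr_sign mul1r.
        exact: YD.
      by rewrite /x; lra.
  rewrite sumEFin sumr_const !card_prod !card_ord card_bool lee_fin.
  rewrite -[leLHS]mulr_natl !natrM -[X in X <= _]subr0 -subr_ge0.
  rewrite (_ : _ - _ = 0)//; field.
  by rewrite !pnatr_eq0 -!lt0n n0 p0.
- move=> w nF s j sn.
  have le b : sgn b * \sum_i cusum_weight s i * Y j (X i w) <= x.
    rewrite leNgt; apply/negP => xS; apply: nF; exists (Ordinal sn, j, b) => //.
    rewrite /F /=; under eq_bigr do rewrite -mulrA.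
    by rewrite -mulr_sumr.
  have := le true; have := le false; rewrite /sgn expr0 expr1 mul1r mulN1r.
  by move=> le0 le1; apply/ler_normlP.
Qed.

End cusum_tails.

(** * Tails of sums with finite moments *)

(** With [y = w / x], taking logarithms reduces this to [ln y <= y], because
    [x / w * ln w <= ln x + ln y / y]. *)
Lemma expR_le_powR (R : realType) (q w x : R) : 0 <= q -> 1 < x -> x <= w ->
  expR (q * ln w / w * x) <= expR q * x `^ q.
Proof.
move=> q0 x1 xw.
have w0 : 0 < w by lra.
have x0 : 0 < x by lra.
rewrite /powR gt_eqF// -expRD ler_expR.
have -> : q * ln w / w * x = q * (x / w * ln w) by field; rewrite gt_eqF.
rewrite -[X in X + _]mulr1 -mulrDr ler_wpM2l//.
have wE : ln w = ln x + ln (w / x).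
  by rewrite -lnM ?posrE ?divr_gt0//; congr ln; field; rewrite gt_eqF.
have y0 : 0 < w / x by rewrite divr_gt0.
have ly : x / w * ln (w / x) <= 1.
  have -> : x / w = (w / x)^-1 by rewrite invf_div.
  rewrite mulrC ler_pdivrMr// mul1r.
  have := @le_ln1Dx R (w / x - 1); rewrite [1 + _]addrC subrK => h.
  by apply: (le_trans (h _)); lra.
have lx : 0 <= ln x by rewrite ln_ge0// ltW.
have xw1 : x / w <= 1 by rewrite ler_pdivrMr// mul1r.
have xw0 : 0 <= x / w by rewrite divr_ge0 ?ltW.
by rewrite wE mulrDr; nra.
Qed.

Section heavy_tails.
Context {d : measure_display} {T : measurableType d} {R : realType}.
Context (P : probability T R).

(** A Fuk-Nagaev type bound.  Either some [W i] exceeds [w], which Markov's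
    inequality for the [q]-th moment rules out, or the sum of the [W i] lying in
    (1, w] exceeds [w].  For the latter use the exponential moment with parameter
    [lam = q ln w / w]: it makes [expR (- lam * w)] equal to [w `^ (- q)], while
    [expR (lam * W i)] stays below a constant multiple of [W i `^ q]. *)
Lemma heavy_sum_tail {d' : measure_display} {U : measurableType d'}
    {I : finType} (X : I -> T -> U) (W : I -> U -> R) (q w : R) :
  mutually_independent P X -> (forall i, measurable_fun setT (X i)) ->
  (forall i, measurable_fun setT (W i)) -> (forall i u, 0 <= W i u) ->
  0 < q -> 1 < w ->
  (\sum_i \int[P]_t (W i (X i t) `^ q)%:E <= 1)%E ->
  exists N : set T, [/\ measurable N,
    (P N <= ((1 + expR (expR q)) * w `^ (- q))%:E)%E &
    forall t, ~ N t ->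
      \sum_i (if 1 < W i (X i t) then W i (X i t) else 0) <= w].
Proof.
move=> indX mX mW W0 q0 w1 Wq.
have w0 : 0 < w by lra.
have lw0 : 0 < ln w by rewrite ln_gt0.
pose V i u := if (1 < W i u) && (W i u <= w) then W i u else 0.
have mV i : measurable_fun setT (V i).
  apply: measurable_fun_ifT => //; apply: measurable_and.
    exact: measurable_fun_ltr.
  exact: measurable_fun_ler.
pose lam := q * ln w / w.
have lam0 : 0 < lam by rewrite divr_gt0// mulr_gt0.
have mWq i : measurable_fun setT (fun t => W i (X i t) `^ q).
  apply: (measurableT_comp (measurable_powR q)).
  exact: measurableT_comp.
pose e i := (\int[P]_t (W i (X i t) `^ q)%:E)%E.
have e0 i : (0 <= e i)%E by apply: integral_ge0 => t _; rewrite lee_fin powR_ge0.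
have efin i : (e i \is a fin_num)%E.
  rewrite ge0_fin_numE//; apply: le_lt_trans (ltry 1); apply: le_trans Wq.
  by rewrite (bigD1 i)//= leeDl//; apply: sume_ge0 => k _; exact: e0.
have fe1 : \sum_i fine (e i) <= 1.
  rewrite -lee_fin -sumEFin; apply: le_trans Wq.
  by apply: lee_sum => i _; rewrite fineK.
have mA i : measurable [set t | w < W i (X i t)].
  by apply: measurable_gt; exact: measurableT_comp.
have [mN1 PN1] := union_bound P mA.
pose N2 := [set t | lam * w < \sum_i lam * V i (X i t)].
have mN2 : measurable N2.
  apply: measurable_gt; apply: measurable_sum => i.
  by apply: measurable_funM => //; exact: measurableT_comp.
have wq : w `^ (- q) = expR (- (lam * w)).
  by rewrite /powR gt_eqF// /lam divfK ?gt_eqF// mulNr.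
exists ((\bigcup_i [set t | w < W i (X i t)]) `|` N2); split.
- exact: measurableU.
- rewrite mulrDl mul1r EFinD; apply: (le_trans (measureU2 _ _ _)) => //.
  apply: leeD.
    apply: (le_trans PN1).
    apply: (@le_trans _ _ (\sum_i (w `^ (- q) * fine (e i))%:E)%E); last first.
      by rewrite sumEFin lee_fin -mulr_sumr ler_piMr// powR_ge0.
    apply: lee_sum => i _.
    rewrite EFinM fineK// -ge0_integralZl_EFin//; last 3 first.
    + by move=> t _; rewrite lee_fin powR_ge0.
    + exact/measurable_EFinP.
    + exact: powR_ge0.
    rewrite -(setIT [set t | _]) -integral_indic//.
    apply: ge0_le_integral => //.
    + by apply/measurable_EFinP.
    + by apply/measurable_EFinP; exact: measurable_funM.
    + move=> t _; rewrite -EFinM lee_fin indicE.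
      have [|_] := boolP (t \in _); last by rewrite mulr_ge0 ?powR_ge0.
      rewrite inE/= => wW; rewrite powRN mulrC ler_pdivlMr ?powR_gt0// mul1r.
      by rewrite ge0_ler_powR ?nnegrE// ?ltW.
  have mgV i : measurable_fun setT (fun u => lam * V i u) by exact: measurable_funM.
  apply: (@le_trans _ _ (expR (\sum_i expR q * fine (e i) - lam * w))%:E).
    apply: (chernoff_independent (g := fun i u => lam * V i u) _ indX mX mgV) => i.
    apply: (@le_trans _ _ (\int[P]_t (1%:E + (expR q)%:E * (W i (X i t) `^ q)%:E))%E).
      apply: ge0_le_integral => //.
      + apply/measurable_EFinP; apply: measurableT_comp => //.
        by apply: measurable_funM => //; exact: measurableT_comp.
      + apply/measurable_EFinP/measurable_funD => //.
        exact: measurable_funM.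
      + move=> t _; rewrite -EFinM -EFinD lee_fin /V.
        case: ifP => [/andP[W1 Ww]|_].
          apply: (le_trans (expR_le_powR (ltW q0) W1 Ww)).
          by rewrite lerDr.
        by rewrite mulr0 expR0 lerDl mulr_ge0 ?powR_ge0 ?expR_ge0.
    rewrite ge0_integralD//; last 2 first.
    + by move=> t _; rewrite -EFinM lee_fin mulr_ge0 ?powR_ge0 ?expR_ge0.
    + by apply/measurable_EFinP; exact: measurable_funM.
    rewrite integral_cst//= probability_setT mule1 ge0_integralZl_EFin//; last 2 first.
    + by move=> t _; rewrite lee_fin powR_ge0.
    + exact/measurable_EFinP.
    by rewrite -/(e i) -(fineK (efin i)) -EFinM -EFinD lee_fin expR_ge1Dx.
  rewrite lee_fin expRD wq ler_wpM2r ?expR_ge0// ler_expR -mulr_sumr.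
  by rewrite ler_piMr ?expR_ge0.
- move=> t /not_orP[nN1 nN2].
  have Ww i : W i (X i t) <= w.
    by rewrite leNgt; apply/negP => wW; apply: nN1; exists i.
  rewrite -(ler_pM2l lam0) mulr_sumr leNgt; apply/negP => wS; apply: nN2.
  rewrite /N2 /=; apply: (lt_le_trans wS); apply: ler_sum => i _.
  by rewrite /V Ww andbT.
Qed.

End heavy_tails.

(** * Random vectors with the maximum norm *)

Lemma continuous_borel_rV {R : realType} {p : nat} (f : 'rV[R]_p -> R) :
  continuous f -> measurable_fun setT (f : borel_rV R p -> R).
Proof.
move=> /continuousP cf; apply: (measurability _ (RGenOpens.measurableE R)).
move=> _ [_ [a [b ->] <-]]; rewrite setTI; apply: sub_sigma_algebra.
exact/cf/interval_open.
Qed.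

Lemma norm_coord_le {R : realType} {p : nat} (v : 'rV[R]_p) (j : 'I_p) :
  `|v ord0 j| <= `|v|.
Proof.
rewrite [leRHS]/Num.Def.normr /= mx_normrE.
by apply: (@le_bigmax _ R _ 0 (fun ij => `|v ij.1 ij.2|) (ord0, j)).
Qed.

Lemma norm_le_coord {R : realType} {p : nat} (v : 'rV[R]_p) (x : R) :
  0 <= x -> (forall j, `|v ord0 j| <= x) -> `|v| <= x.
Proof.
move=> x0 vx; rewrite [leLHS]/Num.Def.normr /= mx_normrE; apply/bigmax_leP; split => //.
by move=> [i j] _ /=; rewrite ord1.
Qed.

Lemma bigmax_coord_powR {R : realType} {p : nat} (v : 'rV[R]_p) (b q : R) :
  0 < b -> 0 < q ->
  \big[Num.max/0]_(j < p) (`|v ord0 j| / b) `^ q = (`|v| / b) `^ q.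
Proof.
move=> b0 q0; apply/eqP; rewrite eq_le; apply/andP; split.
  apply/bigmax_leP; split => [|j _]; first exact: powR_ge0.
  apply: ge0_ler_powR; rewrite ?nnegrE ?divr_ge0 ?(ltW b0) ?(ltW q0)//.
  by rewrite ler_pM2r ?invr_gt0// norm_coord_le.
have [v0|v0] := eqVneq `|v| 0.
  rewrite v0 mul0r powR0 ?gt_eqF//.
  by apply: (big_ind (fun x => 0 <= x)) => // [x y x0 y0|i _]; rewrite ?le_max ?x0 ?powR_ge0.
have [[i j] /= vE] := mx_norm_neq0 v0.
have -> : `|v| = `|v ord0 j| by rewrite [LHS]vE ord1.
by apply: (@le_bigmax _ R _ 0 (fun j => (`|v ord0 j| / b) `^ q) j).
Qed.

Section psi1_moment.
Context {R : realType} {d : measure_display} {T : measurableType d}.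
Context (P : probability T R).

(** The infimum defining the norm need not be attained; doubling [b] leaves room
    for an admissible constant below [2 * b]. *)
Lemma psi1_norm_mgf (X : T -> R) (b : R) : 0 < b -> measurable_fun setT X ->
  (psi1_norm P X <= b%:E)%E ->
  (\int[P]_w (expR (`|X w| / (2 * b)))%:E <= 2%:E)%E.
Proof.
move=> b0 mX Xb.
have [_ [c [c0 Xc] <-]] : exists2 y : \bar R,
    [set c%:E | c in [set c : R | 0 < c /\ ('E_P[fun w => (expR (`|X w| / c) - 1)%R] <= 1)%E]] y &
    (y < (2 * b)%:E)%E.
  by apply: ereal_inf_lt; apply: (le_lt_trans Xb); rewrite lte_fin; lra.
rewrite lte_fin => cb; rewrite unlock in Xc.
have mE k : measurable_fun setT (fun w => expR (`|X w| * k)).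
  apply: measurableT_comp => //; apply: measurable_funM => //.
  exact: measurableT_comp.
apply: (@le_trans _ _ (\int[P]_w ((expR (`|X w| / c) - 1)%:E + 1%:E))%E).
  apply: ge0_le_integral => //.
  - exact/measurable_EFinP.
  - by apply/measurable_EFinP/measurable_funD => //; exact: measurable_funB.
  - move=> w _; rewrite -EFinD subrK lee_fin ler_expR ler_wpM2l//.
    by rewrite lef_pV2 ?posrE ?mulr_gt0// ltW.
rewrite ge0_integralD//; last 2 first.
- move=> w _; rewrite lee_fin subr_ge0 -expR0 ler_expR.
  by rewrite divr_ge0// ltW.
- by apply/measurable_EFinP; exact: measurable_funB.
rewrite integral_cst//= probability_setT mule1 (_ : 2 = 1 + 1)// EFinD.
exact: leeD.
Qed.

End psi1_moment.

Section noise.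
Context {R : realType} {n p : nat} {d : measure_display} {T : measurableType d}.
Context (P : probability T R) (xi : 'I_n -> T -> 'rV[R]_p).
Context (xi_iid : iid_mean_zero P xi) (n_gt0 : (0 < n)%N) (p_gt0 : (0 < p)%N).

Let mxi i : measurable_fun setT (xi i : T -> borel_rV R p).
Proof. by case: xi_iid. Qed.

Let indxi : mutually_independent P (xi : 'I_n -> T -> borel_rV R p).
Proof. by case: xi_iid. Qed.

Let xi_mean0 i j : (\int[P]_w (xi i w ord0 j)%:E = 0)%E.
Proof. by case: xi_iid => _ _ _ /(_ i j); rewrite unlock. Qed.

Let mcoord (j : 'I_p) : measurable_fun setT (fun v : borel_rV R p => (v : 'rV[R]_p) ord0 j).
Proof. by apply: continuous_borel_rV; exact: coord_continuous. Qed.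

Let mnorm : measurable_fun setT (fun v : borel_rV R p => `|v : 'rV[R]_p|).
Proof. by apply: continuous_borel_rV; exact: norm_continuous. Qed.

Let mxij i j : measurable_fun setT (fun w => xi i w ord0 j).
Proof. exact: (measurableT_comp (mcoord j) (mxi i)). Qed.

Lemma cusum_noise_psi1 (b gamma : R) : 0 < b -> 0 < gamma -> condC P b xi ->
  exists N : set T, [/\ measurable N, (P N <= (gamma / 2)%:E)%E &
    forall w, ~ N w -> forall s, (s < n)%N ->
      `|cusum (xi ^~ w) s| <= 4 * b * (4 + ln (4 * (n * p)%:R / gamma))].
Proof.
move=> b0 g0 xiC.
have b4 : 0 < 4 * b by lra.
pose Y (j : 'I_p) (v : borel_rV R p) : R := (4 * b)^-1 * (v : 'rV[R]_p) ord0 j.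
have mY j : measurable_fun setT (Y j) by exact: measurable_funM.
have mYi i j : measurable_fun setT (fun w => Y j (xi i w)).
  exact: (measurableT_comp (mY j) (mxi i)).
have YB i j : (\int[P]_w (expR (2 * `|Y j (xi i w)|))%:E <= 2%:E)%E.
  have := psi1_norm_mgf b0 (mxij i j) (xiC i j).
  congr (_ <= _)%E; apply: eq_integral => w _; congr (expR _)%:E.
  rewrite /Y normrM gtr0_norm ?invr_gt0//.
  by field; rewrite gt_eqF.
have Y0 i j : fine (\int[P]_w (Y j (xi i w))%:E)%E = 0.
  have iY := integrable_mgf (mYi i j) (YB i j).
  have : ((4 * b)%:E * \int[P]_w (Y j (xi i w))%:E = 0)%E.
    rewrite -(integralZl measurableT iY) -[RHS](xi_mean0 i j).
    by apply: eq_integral => w _; rewrite /= -EFinM /Y mulVKf ?gt_eqF.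
  by move=> /eqP; rewrite mule_eq0 eqe gt_eqF//= => /eqP ->.
have YD s j : (s < n)%N ->
    `|\sum_i cusum_weight s i * fine (\int[P]_w (Y j (xi i w))%:E)%E| <= 0.
  by move=> _; rewrite big1 ?normr0// => i _; rewrite Y0 mulr0.
have [N [mN PN NY]] := cusum_sup_tail indxi mxi mY (ler0n _ 2) g0 n_gt0 p_gt0 YB YD.
exists N; split => // w /NY {}NY s sn.
have cE j : cusum (xi ^~ w) s ord0 j = 4 * b * \sum_i cusum_weight s i * Y j (xi i w).
  rewrite cusumE mulr_sumr; apply: eq_bigr => i _.
  by rewrite /Y mulrCA mulVKf ?gt_eqF.
have le j : `|cusum (xi ^~ w) s ord0 j| <= 4 * b * (4 + ln (4 * (n * p)%:R / gamma)).
  rewrite cE normrM (gtr0_norm b4) ler_pM2l//.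
  by apply: (le_trans (NY s j sn)); lra.
apply: norm_le_coord => //.
exact: le_trans (le (Ordinal p_gt0)).
Qed.

(** The first three terms of the level come from the truncated vectors (bias,
    exponential moment, union bound), the last one from the large vectors. *)
Lemma cusum_noise_moment (b q gamma w0 : R) : 0 < b -> 2 < q -> 0 < gamma -> 1 < w0 ->
  (1 + expR (expR q)) * w0 `^ (- q) <= gamma / 2 ->
  condD P b q xi ->
  exists N : set T, [/\ measurable N, (P N <= gamma%:E)%E &
    forall w, ~ N w -> forall s, (s < n)%N ->
      `|cusum (xi ^~ w) s| <=
         b * n%:R `^ q^-1 * (1 + 2 * expR 2 + ln (4 * (n * p)%:R / gamma) + w0)].
Proof.
move=> b0 q2 g0 w1 w0q xiD.
have q0 : 0 < q by lra.
have n0R : 0 < n%:R :> R by rewrite ltr0n.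
pose u := b * n%:R `^ q^-1.
have u0 : 0 < u by rewrite mulr_gt0// powR_gt0.
(* The scale [u] is chosen so that the [q]-th moments of the [W (xi i w)] are at
   most [1 / n]. *)
pose W (v : borel_rV R p) : R := u^-1 * `|v : 'rV[R]_p|.
have mW : measurable_fun setT W by exact: measurable_funM.
have W0 v : 0 <= W v by rewrite /W mulr_ge0// invr_ge0 ltW.
have mWi i : measurable_fun setT (fun w => W (xi i w)).
  exact: (measurableT_comp mW (mxi i)).
have mWq i : measurable_fun setT (fun w => W (xi i w) `^ q).
  exact: (measurableT_comp (measurable_powR q) (mWi i)).
have EW i : (\int[P]_w (W (xi i w) `^ q)%:E <= (n%:R^-1)%:E)%E.
  have := xiD i; rewrite unlock => xiDi.
  have WE w : W (xi i w) `^ q = n%:R^-1 * (`|xi i w| / b) `^ q.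
    have -> : W (xi i w) = n%:R `^ (- q^-1) * (`|xi i w| / b).
      by rewrite /W /u powRN invfM; ring.
    rewrite powRM ?powR_ge0 ?divr_ge0 ?(ltW b0)// -powRrM mulNr mulVf ?gt_eqF//.
    by rewrite powR_inv1 ?ltW.
  have mN : measurable_fun setT (fun w => (`|xi i w| / b) `^ q).
    apply: (measurableT_comp (measurable_powR q)).
    by apply: measurable_funM => //; exact: (measurableT_comp mnorm (mxi i)).
  under eq_integral do rewrite WE EFinM.
  rewrite ge0_integralZl_EFin//; last 2 first.
  - by move=> w _; rewrite lee_fin powR_ge0.
  - exact/measurable_EFinP.
  rewrite -[leRHS]mule1 lee_pmul2l ?lte_fin ?invr_gt0//.
  by under eq_integral do rewrite -(bigmax_coord_powR _ b0 q0).
have W_le v : W v <= 1 + W v `^ q.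
  have [W1|W1] := leP (W v) 1; first by rewrite (le_trans W1)// lerDl powR_ge0.
  rewrite (@le_trans _ _ (W v `^ q))// ?lerDr//.
  by rewrite -[leLHS]powRr1// ler_powR ?ltW//; lra.
have coordW (v : 'rV[R]_p) j : `|u^-1 * v ord0 j| <= W v.
  by rewrite normrM gtr0_norm ?invr_gt0// /W ler_pM2l ?invr_gt0// norm_coord_le.
pose big (v : borel_rV R p) := 1 < W v.
have mbig : measurable_fun setT big by exact: measurable_fun_ltr.
(* Truncation of the scaled coordinate [j] according to the norm of the whole
   vector: [Y] is the bounded part and [Z] the remainder. *)
pose Y (j : 'I_p) (v : borel_rV R p) : R :=
  if big v then 0 else u^-1 * (v : 'rV[R]_p) ord0 j.
pose Z (j : 'I_p) (v : borel_rV R p) : R :=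
  if big v then u^-1 * (v : 'rV[R]_p) ord0 j else 0.
have muc j : measurable_fun setT (fun v : borel_rV R p => u^-1 * (v : 'rV[R]_p) ord0 j).
  exact: measurable_funM.
have mY j : measurable_fun setT (Y j) by exact: measurable_fun_ifT.
have mZ j : measurable_fun setT (Z j) by exact: measurable_fun_ifT.
have mYi i j : measurable_fun setT (fun w => Y j (xi i w)).
  exact: (measurableT_comp (mY j) (mxi i)).
have mZi i j : measurable_fun setT (fun w => Z j (xi i w)).
  exact: (measurableT_comp (mZ j) (mxi i)).
have Y1 j v : `|Y j v| <= 1.
  rewrite /Y /big; case: ltP => W1; first by rewrite normr0.
  exact: le_trans (coordW v j) W1.
have YB i j : (\int[P]_w (expR (2 * `|Y j (xi i w)|))%:E <= (expR 2)%:E)%E.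
  rewrite -[leRHS]mule1 -(probability_setT P) -integral_cst//.
  apply: ge0_le_integral => //.
  - apply/measurable_EFinP; apply: measurableT_comp => //.
    by apply: measurable_funM => //; exact: measurableT_comp.
  - move=> w _; rewrite lee_fin ler_expR -[leRHS]mulr1 ler_wpM2l//.
have ZW j v : `|Z j v| <= W v `^ q.
  rewrite /Z /big; case: ltP => W1; last by rewrite normr0 powR_ge0.
  apply: (le_trans (coordW v j)).
  by rewrite -[leLHS]powRr1// ler_powR ?ltW//; lra.
have iWq i : P.-integrable setT (fun w => (W (xi i w) `^ q)%:E).
  apply/integrableP; split; first exact/measurable_EFinP.
  under eq_integral do rewrite /= ger0_norm ?powR_ge0//.
  by rewrite (le_lt_trans (EW i))// ltry.
have iZ i j : P.-integrable setT (fun w => (Z j (xi i w))%:E).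
  apply: (le_integrable measurableT _ _ (iWq i)); first exact/measurable_EFinP.
  by move=> w _; rewrite lee_fin [leRHS]ger0_norm ?powR_ge0.
have iY i j := integrable_mgf (mYi i j) (YB i j).
(* As [xi i] is centred, the mean of [Y] is minus that of [Z], hence at most the
   [q]-th moment of [W]. *)
have YZ i j : (\int[P]_w (Y j (xi i w))%:E = - \int[P]_w (Z j (xi i w))%:E)%E.
  have YZ0 : (u%:E * (\int[P]_w (Y j (xi i w))%:E + \int[P]_w (Z j (xi i w))%:E) = 0)%E.
    rewrite -integralD//; last exact: iY.
    etransitivity.
      exact/esym/(integralZl measurableT (integrableD measurableT (iY i j) (iZ i j)) u).
    rewrite -[RHS](xi_mean0 i j); apply: eq_integral => w _.
    rewrite /= -EFinD -EFinM /Y /Z; case: ifP => _; rewrite ?add0r ?addr0;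
      by rewrite mulVKf ?gt_eqF.
  have fY := integrable_fin_num measurableT (iY i j).
  have fZ := integrable_fin_num measurableT (iZ i j).
  move/eqP : YZ0; rewrite mule_eq0 eqe gt_eqF//= => /eqP YZ0.
  by rewrite -[LHS](addeK _ fZ) YZ0 sub0e.
have Ym i j : `|fine (\int[P]_w (Y j (xi i w))%:E)%E| <= n%:R^-1.
  rewrite YZ fineN normrN -lee_fin -fine_abse ?(integrable_fin_num measurableT (iZ i j))//.
  rewrite fineK ?abse_fin_num ?(integrable_fin_num measurableT (iZ i j))//.
  apply: (le_trans (le_abse_integral _ _ _)) => //; first exact/measurable_EFinP.
  apply: le_trans (EW i); apply: ge0_le_integral => //.
  - by apply/measurable_EFinP; exact: measurableT_comp.
  - exact/measurable_EFinP.
  - by move=> w _; rewrite lee_fin ZW.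
have YD s j : (s < n)%N ->
    `|\sum_i cusum_weight s i * fine (\int[P]_w (Y j (xi i w))%:E)%E| <= 1.
  move=> sn; apply: (le_trans (ler_norm_sum _ _ _)).
  apply: (@le_trans _ _ (\sum_(i < n) n%:R^-1)); last first.
    by rewrite sumr_const card_ord -[leLHS]mulr_natl divff ?gt_eqF.
  apply: ler_sum => i _; rewrite normrM -[leRHS]mul1r ler_pM//.
  exact: cusum_weight_le1.
have [N1 [mN1 PN1 N1Y]] :=
  cusum_sup_tail indxi mxi mY (expR_ge0 2) g0 n_gt0 p_gt0 YB YD.
have sumW : (\sum_(i < n) \int[P]_w (W (xi i w) `^ q)%:E <= 1)%E.
  apply: (@le_trans _ _ (\sum_(i < n) n%:R^-1%:E)%E); first by apply: lee_sum.
  by rewrite sumEFin sumr_const card_ord lee_fin -[leLHS]mulr_natl divff ?gt_eqF.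
have [N2 [mN2 PN2 N2W]] :=
  heavy_sum_tail indxi mxi (fun=> mW) (fun=> W0) q0 w1 sumW.
exists (N1 `|` N2); split; first exact: measurableU.
  apply: (le_trans (measureU2 _ _ _)) => //.
  rewrite (splitr gamma) EFinD; apply: leeD => //.
  by apply: (le_trans PN2); rewrite lee_fin.
move=> w /not_orP[/N1Y {}N1Y /N2W {}N2W] s sn.
have cE j : cusum (xi ^~ w) s ord0 j = u * (\sum_i cusum_weight s i * Y j (xi i w) +
    \sum_i cusum_weight s i * Z j (xi i w)).
  rewrite cusumE -big_split mulr_sumr; apply: eq_bigr => i _ /=.
  rewrite -mulrDr mulrCA; congr (_ * _).
  by rewrite /Y /Z; case: ifP => _; rewrite ?add0r ?addr0 mulVKf ?gt_eqF.
have le j : `|cusum (xi ^~ w) s ord0 j| <=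
    u * (1 + 2 * expR 2 + ln (4 * (n * p)%:R / gamma) + w0).
  rewrite cE normrM (gtr0_norm u0) ler_pM2l//.
  apply: (le_trans (ler_normD _ _)); apply: lerD; first exact: N1Y.
  apply: (le_trans (ler_norm_sum _ _ _)); apply: le_trans N2W.
  apply: ler_sum => i _; rewrite normrM -[leRHS]mul1r ler_pM//.
    exact: cusum_weight_le1.
  rewrite /Z /big; case: ltP => W1; last by rewrite normr0.
  exact: coordW.
apply: norm_le_coord => //.
exact: le_trans (le (Ordinal p_gt0)).
Qed.

End noise.

(** * The localization rate *)

Lemma cusum_argmax_whp {R : realType} {n p m : nat} {d : measure_display}
    {T : measurableType d} (P : probability T R) (mu delta : 'rV[R]_p)
    (xi : 'I_n -> T -> 'rV[R]_p) (mhat : T -> nat) (N : set T) (gamma rho c : R) :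
  (0 < m < n)%N -> delta != 0 ->
  measurable_fun setT mhat ->
  (forall w, cusum_argmax (fun i => mean_shift m mu delta xi i w) (mhat w)) ->
  measurable N -> (P N <= gamma%:E)%E ->
  (forall w, ~ N w -> forall s, (s < n)%N -> `|cusum (xi ^~ w) s| <= rho) ->
  4 * rho <= c ->
  ((1 - gamma)%R%:E <= P [set w | (`|tloc n (mhat w) - tloc n m| <=
     c / (Num.sqrt (n%:R * tloc n m * (1 - tloc n m)) * `|delta|))%R])%E.
Proof.
move=> m_in d0 mmhat argmax mN PN noise rho_c.
set G := [set w | _].
have mG : measurable G.
  pose A : set nat := [set s | `|tloc n s - tloc n m| <=
     c / (Num.sqrt (n%:R * tloc n m * (1 - tloc n m)) * `|delta|)].
  by rewrite -[G]setTI; apply: (mmhat _ A).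
have NG : ~` N `<=` G.
  move=> w /noise {}noise; rewrite /G /=.
  apply: (@le_trans _ _ (4 * rho / (Num.sqrt (n%:R * tloc n m * (1 - tloc n m)) * `|delta|))).
    by apply: (cusum_argmax_dist m_in d0 _ (argmax w)) => r /andP[_]; exact: noise.
  by rewrite ler_wpM2r// invr_ge0 mulr_ge0// sqrtr_ge0.
apply: (@le_trans _ _ (P (~` N))); last first.
  by apply: le_measure; rewrite ?inE//; exact: measurableC.
by rewrite probability_setC// EFinB leeB.
Qed.

(** Since [n * p >= 12 > e], constants are absorbed by [ln (n * p)]. *)
Lemma union_level_le (R : realType) (n p : nat) (K gamma : R) :
  (4 <= n)%N -> (3 <= p)%N -> 0 < gamma ->
  ln (gamma^-1) <= K * ln (n * p)%:R ->
  1 <= ln (n * p)%:R :> R /\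
  ln (4 * (n * p)%:R / gamma) <= (4 + K) * ln (n * p)%:R.
Proof.
move=> n4 p3 g0 gK.
have np12 : (12 <= n * p)%N by exact: (leq_mul n4 p3).
have np0 : 0 < (n * p)%:R :> R by rewrite ltr0n (leq_trans _ np12).
have L1 : 1 <= ln (n * p)%:R :> R.
  rewrite -ler_expR lnK ?posrE//.
  have e4 : expR 1 <= 4 :> R.
    have h0 : 0 < expR (1 / 2) :> R by exact: expR_gt0.
    have := expR_ge1Dx (- (1 / 2) : R).
    rewrite -(ler_pM2r h0) -expRD addNr expR0 => h.
    have -> : expR 1 = expR (1 / 2) * expR (1 / 2) :> R by rewrite -expRD; congr expR; field.
    by nra.
  by apply: (le_trans e4); rewrite ler_nat (leq_trans _ np12).
split=> //.
have ln4 : ln 4 <= 3 :> R.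
  by have := @le_ln1Dx R 3; rewrite (_ : 1 + 3 = 4 :> R) => [|]; [apply; lra|ring].
rewrite lnM ?posrE ?mulr_gt0 ?invr_gt0// lnM ?posrE//.
by rewrite mulrDl; lra.
Qed.


Theorem theorem3p4 (R : realType) :
  (forall b K : R, 0 < b -> 0 < K ->
    exists2 C : R, 0 < C &
    forall (n p : nat), (4 <= n)%N -> (3 <= p)%N ->
    forall gamma : R, 0 < gamma -> gamma < expR (- 1) ->
      ln (gamma^-1) <= K * ln (n * p)%:R ->
    forall (m : nat) (mu delta : 'rV[R]_p),
      (1 <= m <= n - 1)%N -> delta != 0 ->
    forall (d : measure_display) (T : measurableType d) (P : probability T R)
      (xi : 'I_n -> T -> 'rV[R]_p) (mhat : T -> nat),
      iid_mean_zero P xi -> condB P b xi -> condC P b xi ->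
      measurable_fun [set: T] mhat ->
      (forall w, cusum_argmax (fun i => mean_shift m mu delta xi i w) (mhat w)) ->
      ((1 - gamma)%R%:E <=
       P [set w | (`|tloc n (mhat w) - tloc n m| <=
           C * ln (n * p)%:R ^+ 2 /
           (Num.sqrt (n%:R * tloc n m * (1 - tloc n m)) * `|delta|))%R])%E)
  /\
  (forall b K q : R, 0 < b -> 0 < K -> 2 < q ->
    exists2 C : R, 0 < C &
    forall (n p : nat), (4 <= n)%N -> (3 <= p)%N ->
    forall gamma : R, 0 < gamma -> gamma < expR (- 1) ->
      ln (gamma^-1) <= K * ln (n * p)%:R ->
    forall (m : nat) (mu delta : 'rV[R]_p),
      (1 <= m <= n - 1)%N -> delta != 0 ->
    forall (d : measure_display) (T : measurableType d) (P : probability T R)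
      (xi : 'I_n -> T -> 'rV[R]_p) (mhat : T -> nat),
      iid_mean_zero P xi -> condB P b xi -> condD P b q xi ->
      measurable_fun [set: T] mhat ->
      (forall w, cusum_argmax (fun i => mean_shift m mu delta xi i w) (mhat w)) ->
      ((1 - gamma)%R%:E <=
       P [set w | (`|tloc n (mhat w) - tloc n m| <=
           C * n%:R `^ (q^-1) * (ln (n * p)%:R + gamma `^ (- q^-1)) /
           (Num.sqrt (n%:R * tloc n m * (1 - tloc n m)) * `|delta|))%R])%E).
Proof.
split=> [b K b0 K0|b K q b0 K0 q2].
- exists (16 * b * (8 + K)); first by rewrite !mulr_gt0//; lra.
  move=> n p n4 p3 gamma g0 _ gK m mu delta m_in d0 d T P xi mhat iid _ xiC mm argmax.
  have n0 : (0 < n)%N by exact: leq_trans n4.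
  have p0 : (0 < p)%N by exact: leq_trans p3.
  have {}m_in : (0 < m < n)%N by lia.
  have [L1 Lle] := union_level_le n4 p3 g0 gK.
  have [N [mN PN NX]] := cusum_noise_psi1 iid n0 p0 b0 g0 xiC.
  apply: (cusum_argmax_whp m_in d0 mm argmax mN _ NX).
    by apply: (le_trans PN); rewrite lee_fin; lra.
  set L := ln (n * p)%:R in L1 Lle *.
  have LL : L <= L ^+ 2 by rewrite expr2; nra.
  have KLL : K * L <= K * L ^+ 2 by rewrite ler_pM2l.
  have -> : 16 * b * (8 + K) * L ^+ 2 = 4 * (4 * b * ((8 + K) * L ^+ 2)) by ring.
  rewrite !ler_pM2l ?mulr_gt0//.
  by move: Lle; rewrite !mulrDl; lra.
(* [A ^ q] is the constant for which the tail bound of [heavy_sum_tail] at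
   [w = A * gamma `^ (- q^-1)] equals [gamma / 2]. *)
- pose A := (2 * (1 + expR (expR q))) `^ q^-1.
  pose M := 5 + 2 * expR 2 + K + A.
  have q0 : 0 < q by lra.
  have A0 : 0 < A by apply: powR_gt0; rewrite mulr_gt0// addr_gt0 ?expR_gt0.
  have e0 := expR_gt0 (2 : R).
  have M0 : 0 < M by rewrite /M; lra.
  exists (4 * b * M); first by rewrite !mulr_gt0//; lra.
  move=> n p n4 p3 gamma g0 g1 gK m mu delta m_in d0 d T P xi mhat iid _ xiD mm argmax.
  have n0 : (0 < n)%N by exact: leq_trans n4.
  have p0 : (0 < p)%N by exact: leq_trans p3.
  have {}m_in : (0 < m < n)%N by lia.
  have [L1 Lle] := union_level_le n4 p3 g0 gK.
  have g1' : gamma < 1 by rewrite (lt_trans g1)// -expR0 ltr_expR; lra.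
  set gq := gamma `^ (- q^-1).
  have E1 : 1 < 2 * (1 + expR (expR q)) by have := expR_gt0 (expR q); lra.
  have A1 : 1 < A.
    rewrite /A /powR gt_eqF; last lra.
    by rewrite pexpR_gt1// mulr_gt0 ?invr_gt0// ln_gt0.
  have gq1 : 1 < gq.
    rewrite /gq /powR gt_eqF// pexpR_gt1// mulNr -mulrN mulr_gt0 ?invr_gt0//.
    by rewrite oppr_gt0 ln_lt0// g0.
  have w1 : 1 < A * gq by nra.
  have wq : (1 + expR (expR q)) * (A * gq) `^ (- q) <= gamma / 2.
    rewrite powRM ?powR_ge0// /A /gq -!powRrM mulrNN mulrN mulVf ?gt_eqF//.
    rewrite powRr1 ?(ltW g0)// powR_inv1; last lra.
    rewrite (_ : _ * _ = gamma / 2)//; field.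
    by rewrite gt_eqF//; lra.
  have [N [mN PN NX]] := cusum_noise_moment iid n0 p0 b0 q2 g0 w1 wq xiD.
  apply: (cusum_argmax_whp m_in d0 mm argmax mN PN NX).
  set L := ln (n * p)%:R in L1 Lle *.
  have nq0 : 0 < n%:R `^ q^-1 :> R by rewrite powR_gt0// ltr0n.
  have -> : 4 * b * M * n%:R `^ q^-1 * (L + gq) = 4 * (b * n%:R `^ q^-1 * (M * (L + gq))).
    by ring.
  rewrite !ler_pM2l ?mulr_gt0//.
  move: Lle; rewrite /M !mulrDl !mulrDr; nra.
Qed.
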